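(* Let $A\in\mathbb{R}^{n\times n}$ be symmetric with $\sigma(A)\subset[a,b]$, let $f:[a,b]\to\mathbb{R}$ be continuous, let $d\geq 1$ be an integer, and let $C_1,\dots,C_m$ be a distance-$d$ coloring of $\mathcal{G}(A)$ with $n_\ell=|C_\ell|$. Suppose that $[f(A)]_{ij}$ has constant sign for all $i,j$ with $\mathrm{d}(i,j)>d$ (i.e. either $[f(A)]_{ij}\ge0$ for all such $i,j$, or $[f(A)]_{ij}\le0$ for all such $i,j$). For $\ell=1,\dots,m$ let $V_\ell$ be the variance of $\boldsymbol{w}_\ell^Tf(A)\boldsymbol{w}_\ell$, where $\boldsymbol{w}_\ell$ is a Rademacher probing vector associated with $C_\ell$. Then for every $\ell$ $$V_\ell\le n_\ell\cdot4\,\big(E_d(f,[a,b])\big)^2.$$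
   Context: $\sigma(A)$ is the spectrum of $A$. For symmetric $A$, $f(A)$ is the matrix function defined through the spectral decomposition. $[M]_{ij}$ is the $(i,j)$ entry of $M$. $\mathcal{G}(A)=(V,E)$ is the undirected graph with $V=\{1,\dots,n\}$ and $E=\{(i,j): i\ne j,\ [A]_{ij}\ne 0\}$; $\mathrm{d}(i,j)$ is the geodesic (shortest path) distance in $\mathcal{G}(A)$ ($\infty$ if there is no path). A distance-$d$ coloring with $m$ colors is a partition of $V$ of the form $C_\ell=\{i:\operatorname{col}(i)=\ell\}$, $\ell=1,\dots,m$, for a map $\operatorname{col}:V\to\{1,\dots,m\}$ satisfying $\operatorname{col}(i)\ne\operatorname{col}(j)$ whenever $i\ne j$ and $\mathrm{d}(i,j)\le d$. A Rademacher probing vector associated with $C_\ell$ is a random vector $\sum_{i\in C_\ell}X_i\boldsymbol{e}_i$, where $\boldsymbol{e}_i$ is the $i$th canonical basis vector of $\mathbb{R}^n$ and the $X_i$ are i.i.d. taking the values $\pm1$ with probability $\tfrac12$ each; one has $V_\ell=2\sum_{i,j\in C_\ell,\,i\ne j}|[f(A)]_{ij}|^2$. The polynomial approximation error is $E_d(f,[a,b])=\min_{p\in\Pi_d}\max_{x\in[a,b]}|f(x)-p(x)|$, where $\Pi_d$ is the set of real polynomials of degree at most $d$. *)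

(* Defs.v *)
From HB Require Import structures.
From mathcomp Require Import all_boot all_order all_algebra.
From mathcomp Require Import all_classical all_reals all_analysis.
From mathcomp Require Import ring.
From mathcomp Require Import -(notations) complex.

Set Implicit Arguments.
Unset Strict Implicit.
Unset Printing Implicit Defensive.

Import Order.TTheory GRing.Theory Num.Theory.
Import numFieldNormedType.Exports.

Local Open Scope classical_set_scope.
Local Open Scope ring_scope.

Definition spectrum (R : realType) (n : nat) (A : 'M[R]_n) : set R :=
  [set x | eigenvalue A x].

Definition spectral_decomp (R : realType) (n : nat) (A Q : 'M[R]_n)
    (l : 'rV[R]_n) : Prop :=
  Q *m Q^T = 1%:M /\ A = Q *m diag_mx l *m Q^T.

(* Meant for symmetric [A]: a decomposition then exists ([spectral_decomp_ex])
   and the value does not depend on the chosen one ([matfunE]). *)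
Definition matfun (R : realType) (n : nat) (f : R -> R) (A : 'M[R]_n) : 'M[R]_n :=
  let D := xget (1%:M, 0) [set D : 'M[R]_n * 'rV[R]_n | spectral_decomp A D.1 D.2] in
  D.1 *m diag_mx (map_mx f D.2) *m D.1^T.

Definition adj (R : realType) (n : nat) (A : 'M[R]_n) : rel 'I_n :=
  fun i j => (i != j) && (A i j != 0).

(* The infimum of an empty set being [+oo], this is [+oo] exactly when there is
   no path from [i] to [j]. *)
Definition gdist (R : realType) (n : nat) (A : 'M[R]_n) (i j : 'I_n) : \bar R :=
  ereal_inf [set (size p)%:R%:E | p in [set p : seq 'I_n |
    path (adj A) i p /\ last i p = j]].

Definition distance_coloring (R : realType) (n m : nat) (A : 'M[R]_n) (d : nat)
    (col : 'I_n -> 'I_m) : Prop :=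
  forall i j, i != j -> (gdist A i j <= d%:R%:E)%E -> col i != col j.

Definition color_class (n m : nat) (col : 'I_n -> 'I_m) (l : 'I_m) : {set 'I_n} :=
  [set i | col i == l]%SET.

(* For continuous [f] and [a <= b], the supremum is a maximum and the infimum
   is a minimum. *)
Definition best_approx_error (R : realType) (d : nat) (f : R -> R) (a b : R) : R :=
  inf [set sup [set `|f x - p.[x]| | x in `[a, b]] | p in
    [set p : {poly R} | (size p <= d.+1)%N]].

Definition rademacher (R : realType) (disp : measure_display)
    (T : measurableType disp) (P : probability T R) (X : {RV P >-> R}) : Prop :=
  P (X @^-1` [set 1]) = (2^-1)%:E /\ P (X @^-1` [set -1]) = (2^-1)%:E.

Definition mutually_independent (R : realType) (disp : measure_display)
    (T : measurableType disp) (P : probability T R) (n : nat) (C : {set 'I_n})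
    (X : 'I_n -> {RV P >-> R}) : Prop :=
  forall (J : {set 'I_n}) (B : 'I_n -> set R), J \subset C ->
    (forall i, measurable (B i)) ->
    P (\bigcap_(i in [set` J]) (X i @^-1` B i)) =
      (\prod_(i in J) P (X i @^-1` B i))%E.

(* Only the [X i] with [i \in C] matter. *)
Definition rademacher_probing (R : realType) (disp : measure_display)
    (T : measurableType disp) (P : probability T R) (n : nat) (C : {set 'I_n})
    (w : T -> 'cV[R]_n) : Prop :=
  exists X : 'I_n -> {RV P >-> R},
    [/\ forall i, i \in C -> rademacher (X i),
        mutually_independent C X &
        forall t, w t = \sum_(i in C) X i t *: delta_mx i 0].

Definition quad_form (R : realType) (n : nat) (M : 'M[R]_n) (w : 'cV[R]_n) : R :=
  (w^T *m M *m w) 0 0.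

Lemma spectral_matfun_uniq (R : realType) n (f : R -> R) (A Q Q' : 'M[R]_n) l l' :
  spectral_decomp A Q l -> spectral_decomp A Q' l' ->
  Q *m diag_mx (map_mx f l) *m Q^T = Q' *m diag_mx (map_mx f l') *m Q'^T.
Proof.
move=> [QQ AQ] [QQ' AQ'].
have QtQ : Q^T *m Q = 1%:M by apply: mulmx1C.
have QtQ' : Q'^T *m Q' = 1%:M by apply: mulmx1C.
set U := Q^T *m Q'.
have UE : diag_mx l *m U = U *m diag_mx l'.
  have : Q^T *m A *m Q' = Q^T *m A *m Q' by [].
  rewrite {1}AQ AQ' !mulmxA QtQ mul1mx -!mulmxA QtQ' mulmx1 !mulmxA.
  by rewrite -(mulmxA (diag_mx l)).
have fUE : diag_mx (map_mx f l) *m U = U *m diag_mx (map_mx f l').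
  apply/matrixP => i j; move/matrixP/(_ i j): UE.
  rewrite !mul_diag_mx !mul_mx_diag !mxE => h.
  have [->|Un0] := eqVneq ((\sum_k Q^T i k * Q' k j) : R) 0.
    by rewrite mulr0 mul0r.
  move: h; rewrite mulrC => /(mulfI Un0) ->.
  by rewrite mulrC.
have : Q *m (diag_mx (map_mx f l) *m U) *m Q'^T
     = Q *m (U *m diag_mx (map_mx f l')) *m Q'^T by rewrite fUE.
by rewrite /U !mulmxA QQ mul1mx -(mulmxA _ Q') QQ' mulmx1.
Qed.

Lemma sqnorm_ge0 (R : realType) n (z : 'rV[R]_n) : 0 <= (z *m z^T) 0 0.
Proof. by rewrite mxE; apply: sumr_ge0 => i _; rewrite mxE -expr2 sqr_ge0. Qed.

Lemma sqnorm_eq0 (R : realType) n (z : 'rV[R]_n) : (z *m z^T) 0 0 = 0 -> z = 0.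
Proof.
rewrite mxE => /eqP; rewrite psumr_eq0 => [/allP h|i _]; last first.
  by rewrite mxE -expr2 sqr_ge0.
apply/rowP => i; have := h i (mem_index_enum i).
by rewrite !mxE mulf_eq0 orbb => /eqP.
Qed.

Lemma real_eigenvalue_ex (R : realType) n (A : 'M[R]_n) : (0 < n)%N -> A^T = A ->
  exists a, eigenvalue A a.
Proof.
move=> n_gt0 AT.
pose rc := complex.real_complex R.
have [c /eigenvalueP[v vB vn0]] := eigenvalue_closed (map_mx rc A) n_gt0.
pose al := complex.Re c; pose be := complex.Im c.
pose x := map_mx (@complex.Re R) v; pose y := map_mx (@complex.Im R) v.
have sumRe (F : 'I_n -> complex.complex R) :
    complex.Re (\sum_i F i) = \sum_i complex.Re (F i).
  by apply: (big_morph (@complex.Re R)) => // [[? ?] [? ?]].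
have sumIm (F : 'I_n -> complex.complex R) :
    complex.Im (\sum_i F i) = \sum_i complex.Im (F i).
  by apply: (big_morph (@complex.Im R)) => // [[? ?] [? ?]].
have xA : x *m A = al *: x - be *: y.
  apply/rowP => j; have /rowP/(_ j)/(congr1 (@complex.Re R)) := vB.
  rewrite !mxE sumRe => h; rewrite /al /be.
  transitivity (complex.Re (c * v 0 j)); last by case: (c); case: (v 0 j).
  rewrite -h; apply: eq_bigr => k _; rewrite !mxE /rc.
  by case: (v 0 k) => p q /=; rewrite mulr0 subr0.
have yA : y *m A = be *: x + al *: y.
  apply/rowP => j; have /rowP/(_ j)/(congr1 (@complex.Im R)) := vB.
  rewrite !mxE sumIm => h; rewrite /al /be.
  transitivity (complex.Im (c * v 0 j)); last first.
    by case: (c); case: (v 0 j) => p q r s /=; rewrite addrC.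
  rewrite -h; apply: eq_bigr => k _; rewrite !mxE /rc.
  by case: (v 0 k) => p q /=; rewrite mulr0 add0r.
have sym : (x *m A *m y^T) 0 0 = (y *m A *m x^T) 0 0.
  rewrite -[in RHS](trmxK (y *m A *m x^T)) [in RHS]mxE.
  by rewrite !trmx_mul trmxK AT mulmxA.
have xy : (y *m x^T) 0 0 = (x *m y^T) 0 0.
  by rewrite -[in RHS](trmxK (x *m y^T)) [in RHS]mxE trmx_mul trmxK.
have be0 : be * ((x *m x^T) 0 0 + (y *m y^T) 0 0) = 0.
  have entB (M N : 'M[R]_1) : (M - N) 0 0 = M 0 0 - N 0 0 by rewrite !mxE.
  have entD (M N : 'M[R]_1) : (M + N) 0 0 = M 0 0 + N 0 0 by rewrite !mxE.
  have entZ k (M : 'M[R]_1) : (k *: M) 0 0 = k * M 0 0 by rewrite !mxE.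
  move: sym; rewrite xA yA mulmxBl mulmxDl -!scalemxAl entB entD !entZ xy.
  by rewrite addrC => /addIr h; rewrite mulrDr -h addNr.
have xyn0 : ~ (x = 0 /\ y = 0).
  move=> [x0 y0]; case/eqP: vn0; apply/rowP => i.
  have := congr1 (fun M : 'rV[R]_n => M 0 i) x0.
  have := congr1 (fun M : 'rV[R]_n => M 0 i) y0.
  by rewrite !mxE; case: (v 0 i) => p q /= -> ->.
have b0 : be = 0.
  move/eqP: be0; rewrite mulf_eq0 => /orP[/eqP//|].
  by rewrite paddr_eq0 ?sqnorm_ge0// => /andP[/eqP/sqnorm_eq0 x0 /eqP/sqnorm_eq0 y0]; case: xyn0.
exists al; apply/eigenvalueP.
have [x0|xn0] := eqVneq x 0; last by exists x; rewrite // xA b0 scale0r subr0.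
exists y; first by rewrite yA b0 scale0r add0r.
by apply/eqP => y0; apply: xyn0.
Qed.

Lemma householder_ex (R : realType) n (v : 'rV[R]_(1 + n)) : v *m v^T = 1%:M ->
  exists H : 'M[R]_(1 + n), [/\ H^T = H, H *m H = 1%:M & row 0 H = v].
Proof.
move=> vv; pose e : 'rV[R]_(1 + n) := delta_mx 0 0.
have [->|vne] := eqVneq v e.
  by exists 1%:M; rewrite trmx1 mulmx1 row1.
pose u := e - v; pose s := (u *m u^T) 0 0.
have ee : e *m e^T = 1%:M.
  by rewrite /e trmx_delta mul_delta_mx; apply/matrixP=> i j; rewrite !mxE !ord1.
have ev : e *m v^T = (v 0 0)%:M.
  by rewrite /e -rowE; apply/matrixP => i j; rewrite !mxE !ord1.
have ve : v *m e^T = (v 0 0)%:M.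
  by rewrite -[LHS]trmxK trmx_mul trmxK ev tr_scalar_mx.
have eu : e *m u^T = (1 - v 0 0)%:M.
  by rewrite /u linearB /= mulmxBr ee ev raddfB.
have uuE : u *m u^T = s%:M by rewrite {1}[u *m u^T]mx11_scalar.
have sE : s = 2 * (1 - v 0 0).
  rewrite /s {1}/u mulmxBl eu /u linearB /= mulmxBr ve vv !mxE /=.
  by rewrite !mulr1n mulr_natl mulr2n opprB.
have sn0 : s != 0.
  by apply: contra vne => /eqP/sqnorm_eq0/eqP; rewrite subr_eq0 eq_sym.
have XX : (u^T *m u) *m (u^T *m u) = s *: (u^T *m u).
  by rewrite mulmxA -(mulmxA u^T u) uuE mul_mx_scalar -scalemxAl.
exists (1%:M - (2 / s) *: (u^T *m u)); split.
- by rewrite linearB linearZ /= trmx1 trmx_mul trmxK.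
- move: (u^T *m u) XX => X XX.
  rewrite mulmxBl mul1mx mulmxBr mulmx1 -scalemxAl -scalemxAr XX !scalerA.
  have -> : 2 / s * (2 / s) * s = 2 / s + 2 / s by field.
  by rewrite scalerDl opprB addrK subrK.
- rewrite rowE -/e mulmxBr mulmx1 -scalemxAr mulmxA eu mul_scalar_mx scalerA.
  have -> : 2 / s * (1 - v 0 0) = 1 by rewrite mulrAC -sE divff.
  by rewrite scale1r /u opprB addrC subrK.
Qed.

Lemma spectral_decomp_ex (R : realType) n (A : 'M[R]_n) : A^T = A ->
  exists Q l, spectral_decomp A Q l.
Proof.
elim: n A => [A _|n IH A AT].
  by exists 1%:M, 0; split; apply/matrixP => -[].
have [a /eigenvalueP[v vA vn0]] := real_eigenvalue_ex (ltn0Sn n) AT.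
pose s := (v *m v^T) 0 0.
have s_gt0 : 0 < s.
  rewrite lt_neqAle eq_sym sqnorm_ge0 andbT.
  by apply: contra vn0 => /eqP/sqnorm_eq0 ->.
pose w : 'rV[R]_(1 + n) := (Num.sqrt s)^-1 *: v.
have ww : w *m w^T = 1%:M.
  rewrite /w linearZ /= -scalemxAl -scalemxAr scalerA [v *m v^T]mx11_scalar -/s.
  rewrite -invfM -[_ * Num.sqrt s]expr2 sqr_sqrtr ?ltW// scale_scalar_mx mulVf//.
  by rewrite gt_eqF.
have wA : w *m (A : 'M[R]_(1 + n)) = a *: w.
  by rewrite /w -scalemxAl vA !scalerA mulrC.
have [H [HT HH Hw]] := householder_ex ww.
pose B : 'M[R]_(1 + n) := H *m (A : 'M[R]_(1 + n)) *m H.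
have BT : B^T = B by rewrite /B !trmx_mul HT AT mulmxA.
have B0 : row 0 B = a *: delta_mx 0 0.
  by rewrite /B !row_mul Hw wA -scalemxAl -Hw -row_mul HH row1.
have lsh0 (i : 'I_1) : lshift n i = 0 :> 'I_(1 + n) by rewrite ord1; apply/val_inj.
have B0j j : B 0 j = a * (j == 0)%:R.
  by move/rowP/(_ j): B0; rewrite [row 0 B 0 j]mxE [RHS]mxE [delta_mx _ _ _ _]mxE eqxx.
have Bur : ursubmx B = 0.
  by apply/matrixP => i j; rewrite /ursubmx /usubmx 2!mxE lsh0 B0j mulr0 [RHS]mxE.
have Bul : ulsubmx B = a%:M.
  apply/matrixP => i j; rewrite /ulsubmx /usubmx 2!mxE !lsh0 B0j mulr1.
  by rewrite [RHS]mxE !ord1.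
have BE : B = block_mx a%:M 0 0 (drsubmx B).
  rewrite -[LHS]submxK Bul Bur; congr block_mx.
  by rewrite -[LHS]trmxK trmx_dlsub BT Bur trmx0.
have BdT : (drsubmx B)^T = drsubmx B by rewrite trmx_drsub BT.
have [Q [l [QQ QE]]] := IH _ BdT.
pose K : 'M[R]_(1 + n) := block_mx 1%:M 0 0 Q.
have KT : K^T = block_mx 1%:M 0 0 Q^T by rewrite /K tr_block_mx trmx1 !trmx0.
have KK : K *m K^T = 1%:M.
  rewrite KT /K mulmx_block !(mulmx0, mul0mx, addr0, add0r, mulmx1) QQ.
  by rewrite -scalar_mx_block.
exists (H *m K), (row_mx a%:M l); split.
  by rewrite trmx_mul HT mulmxA -(mulmxA H K) KK mulmx1.
have -> : diag_mx (row_mx a%:M l) = block_mx a%:M 0 0 (diag_mx l).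
  by rewrite diag_mx_row; congr block_mx; apply/matrixP=> i j; rewrite !mxE !ord1.
have AE : A = H *m B *m H :> 'M[R]_(1 + n).
  by rewrite /B !mulmxA HH mul1mx -mulmxA HH mulmx1.
have BK : B = K *m block_mx a%:M 0 0 (diag_mx l) *m K^T.
  rewrite [LHS]BE KT /K !mulmx_block.
  by rewrite !(mulmx0, mul0mx, addr0, add0r, mulmx1, mul1mx) -QE.
by rewrite [LHS]AE BK trmx_mul HT !mulmxA.
Qed.

Lemma matfunE (R : realType) n (f : R -> R) (A Q : 'M[R]_n) l :
  spectral_decomp A Q l -> matfun f A = Q *m diag_mx (map_mx f l) *m Q^T.
Proof.
move=> AQ; rewrite /matfun; case: xgetP => [[Q' l'] _ /= AQ'|].
  exact: spectral_matfun_uniq AQ' AQ.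
by move=> /(_ (Q, l)).
Qed.

(* Main.v *)
(* For a polynomial p of degree at most d, p(A) vanishes at the entries (i, j)
   with d(i, j) > d, so there f(A) agrees with (f - p)(A); since the squared norm
   of a row of (f - p)(A) is a diagonal entry of (f - p)(A)^2, it is at most the
   square of the maximum of |f - p| over [a, b]. Optimizing over p, each row of
   f(A), restricted to the other vertices of the color class, has squared norm at
   most E_d^2. Expanding the quadratic form in Walsh functions (products of the
   signs), which are orthonormal, gives V = 2 * sum_(i <> j in C) f(A)_ij^2, and
   summing the row bounds yields even V <= 2 n E_d^2. *)
Require Import Defs.
From mathcomp Require Import all_boot all_order all_algebra.
From mathcomp Require Import all_classical all_reals all_analysis.
From mathcomp Require Import measurable_realfun ring.
Import Order.TTheory GRing.Theory Num.Theory.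
Import numFieldNormedType.Exports.
Local Open Scope classical_set_scope.
Local Open Scope ring_scope.

Set Implicit Arguments.
Unset Strict Implicit.
Unset Printing Implicit Defensive.

(** * Entries of matrix functions and their vanishing at long graph distance *)

Lemma matfunEE (R : realType) (n : nat) (f : R -> R) (A Q : 'M[R]_n) (e : 'rV[R]_n)
    (i j : 'I_n) : spectral_decomp A Q e ->
  matfun f A i j = \sum_k Q i k * f (e 0 k) * Q j k.
Proof.
move=> AQ; rewrite (matfunE _ AQ) mul_mx_diag mxE.
by apply: eq_bigr => k _; rewrite !mxE.
Qed.

(** Carries bounds on the spectrum over to the diagonal of a decomposition. As [eigenvalue] refers
    to row vectors, the eigenvector is a row of [Q^T]. *)
Lemma spectral_decomp_spectrum (R : realType) (n : nat) (A Q : 'M[R]_n)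
    (e : 'rV[R]_n) (k : 'I_n) : spectral_decomp A Q e -> spectrum A (e 0 k).
Proof.
move=> [QQ AQ]; have QtQ : Q^T *m Q = 1%:M by exact: mulmx1C.
apply/eigenvalueP; exists (row k Q^T).
  rewrite -row_mul AQ !mulmxA QtQ mul1mx row_mul row_diag_mx -scalemxAl.
  by rewrite -rowE.
apply/eqP => Q0; have /matrixP/(_ k k) := QtQ; rewrite !mxE eqxx => /eqP.
rewrite big1 ?(eq_sym 0) ?oner_eq0// => j _.
by have /rowP/(_ j) := Q0; rewrite !mxE => ->; rewrite mul0r.
Qed.

(** A nonzero entry of $A^k$ comes from a nonzero product of $k$ entries of [A], that is, from a
    walk of at most $k$ edges. *)
Lemma matfun_monomial_eq0 (R : realType) (n : nat) (A : 'M[R]_n) (d k : nat)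
    (i j : 'I_n) : A^T = A -> (k <= d)%N -> (d%:R%:E < gdist A i j)%E ->
  matfun (fun x => x ^+ k) A i j = 0.
Proof.
move=> /spectral_decomp_ex[Q [e AQ]] kd dij.
have [QQ AE] := AQ.
have QtQ : Q^T *m Q = 1%:M by exact: mulmx1C.
suff Ak (h : 'I_n) : matfun (fun x => x ^+ k) A h j != 0 ->
    exists p, [/\ (size p <= k)%N, path (adj A) h p & last h p = j].
  apply/eqP; apply: contraTT dij => /Ak[p [pk hp pj]].
  rewrite -leNgt; apply: (@le_trans _ _ (size p)%:R%:E).
    by apply: ereal_inf_lbound; exists p.
  by rewrite lee_fin ler_nat (leq_trans pk).
elim: k {kd dij} h => [|k IH] h.
  rewrite (matfunEE _ _ _ AQ).
  have -> : \sum_k Q h k * e 0 k ^+ 0 * Q j k = (h == j)%:R.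
    have /matrixP/(_ h j) := QQ; rewrite !mxE => <-.
    by apply: eq_bigr => u _; rewrite expr0 mulr1 mxE.
  by have [->|_] := eqVneq h j; rewrite ?eqxx// => _; exists [::].
(* Splitting off the left factor of $A \cdot A^k$ extends the walk at its start, which is why the
   claim is proved for every [h]. *)
have -> : matfun (fun x => x ^+ k.+1) A h j =
    \sum_g A h g * matfun (fun x => x ^+ k) A g j.
  have <- : (A *m matfun (fun x => x ^+ k) A) h j =
    \sum_g A h g * matfun (fun x => x ^+ k) A g j by rewrite mxE.
  rewrite (matfunEE _ _ _ AQ) (matfunE _ AQ) [X in X *m _]AE !mulmxA.
  rewrite -(mulmxA (Q *m _)) QtQ mulmx1 -(mulmxA Q) mulmx_diag mul_mx_diag mxE.
  by apply: eq_bigr => u _; rewrite !mxE exprS.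
move=> s0; have [g Hg] : exists g, A h g * matfun (fun x => x ^+ k) A g j != 0.
  by apply/existsP; apply: contraNT s0; rewrite negb_exists => /forallP s0;
     rewrite big1// => g _; apply/eqP; rewrite -[_ == _]negbK s0.
move: Hg; rewrite mulf_eq0 negb_or => /andP[Ahg /IH[p [pk gp pj]]].
(* A diagonal entry of [A] is not an edge: the walk then stays at [h], so its length is only bounded
   by the exponent. *)
have [hg|hg] := eqVneq h g.
  by exists p; split; rewrite ?hg ?(leq_trans pk).
by exists (g :: p); split => //=; rewrite /adj hg Ahg.
Qed.

Lemma matfun_poly_eq0 (R : realType) (n : nat) (A : 'M[R]_n) (d : nat)
    (p : {poly R}) (i j : 'I_n) :
  A^T = A -> (size p <= d.+1)%N -> (d%:R%:E < gdist A i j)%E ->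
  matfun (horner p) A i j = 0.
Proof.
move=> AT pd dij; have [Q [e AQ]] := spectral_decomp_ex AT.
rewrite (matfunEE _ _ _ AQ).
transitivity (\sum_(k < d.+1) p`_k * matfun (fun x => x ^+ k) A i j).
  under [RHS]eq_bigr do rewrite (matfunEE _ _ _ AQ) mulr_sumr.
  rewrite exchange_big/=; apply: eq_bigr => k _.
  rewrite (horner_coef_wide _ pd) mulr_sumr mulr_suml.
  by apply: eq_bigr => u _; rewrite mulrCA -!mulrA.
by rewrite big1// => k _; rewrite (matfun_monomial_eq0 _ _ dij) ?mulr0// -ltnS.
Qed.

(** * Row norms of matrix functions and best polynomial approximation *)

Lemma matfun_sym (R : realType) (n : nat) (g : R -> R) (A : 'M[R]_n) :
  A^T = A -> (matfun g A)^T = matfun g A.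
Proof.
move=> /spectral_decomp_ex[Q [e AQ]].
by rewrite (matfunE _ AQ) !trmx_mul trmxK tr_diag_mx mulmxA.
Qed.

(** The sum is the diagonal entry of $g(A)^2$, an average of the squares $g(\lambda_k)^2$ with
    weights [Q i k ^+ 2], which add up to 1 because the rows of [Q] are unit vectors. *)
Lemma matfun_row_sqr (R : realType) (n : nat) (g : R -> R) (A : 'M[R]_n) (c : R)
    (i : 'I_n) : A^T = A -> (forall x, spectrum A x -> `|g x| <= c) ->
  \sum_j matfun g A i j ^+ 2 <= c ^+ 2.
Proof.
move=> AT gc; have [Q [e AQ]] := spectral_decomp_ex AT.
have [QQ _] := AQ; have QtQ : Q^T *m Q = 1%:M by exact: mulmx1C.
have -> : \sum_j matfun g A i j ^+ 2 = \sum_k Q i k ^+ 2 * g (e 0 k) ^+ 2.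
  transitivity ((matfun g A *m (matfun g A)^T) i i).
    by rewrite [RHS]mxE; apply: eq_bigr => j _; rewrite [(_^T) _ _]mxE expr2.
  rewrite matfun_sym// (matfunE _ AQ) !mulmxA -(mulmxA (Q *m _)) QtQ mulmx1.
  rewrite -(mulmxA Q) mulmx_diag mul_mx_diag mxE.
  by apply: eq_bigr => k _; rewrite !mxE mulrAC -!expr2.
have <- : \sum_k Q i k ^+ 2 * c ^+ 2 = c ^+ 2.
  have /matrixP/(_ i i) := QQ; rewrite !mxE eqxx => Qi.
  rewrite -mulr_suml (eq_bigr (fun k => Q i k * Q^T k i)) ?Qi ?mul1r// => k _.
  by rewrite mxE expr2.
apply: ler_sum => k _; rewrite ler_wpM2l ?sqr_ge0//.
rewrite -[leLHS]real_normK ?num_real// lerXn2r ?nnegrE//.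
  by apply: le_trans (gc _ (spectral_decomp_spectrum k AQ)).
exact/gc/(spectral_decomp_spectrum k AQ).
Qed.

(** Continuity enters through the extreme value theorem: the errors are bounded, so [sup] is a
    genuine upper bound and not its default value 0. *)
Lemma le_approx_error (R : realType) (p : {poly R}) (f : R -> R) (a b x : R) :
  {within `[a, b], continuous f} -> x \in `[a, b] ->
  `|f x - p.[x]| <= sup [set `|f x - p.[x]| | x in `[a, b]].
Proof.
move=> fc xab; have ab : a <= b.
  by move: xab; rewrite in_itv/= => /andP[/le_trans]; exact.
have gc : {within `[a, b], continuous (fun x => `|f x - p.[x]|)}.
  apply: (@within_continuous_comp _ _ _ _ (fun x => f x - p.[x]) Num.norm).
    by move=> y _; exact: norm_continuous.
  apply: within_continuousB => //.
  by apply: continuous_subspaceT => y; exact: continuous_horner.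
have [c cab cmax] := EVT_max ab gc.
apply: ub_le_sup.
  by exists `|f c - p.[c]| => _ [y /= yab <-]; exact: cmax.
by exists x.
Qed.

Lemma sup_ge0 (R : realType) (E : set R) : (forall x, E x -> 0 <= x) -> 0 <= sup E.
Proof.
move=> E0; have [/[dup] Es [[x Ex] _]|/sup_out->//] := pselect (has_sup E).
exact: le_trans (E0 _ Ex) (sup_upper_bound Es Ex).
Qed.

Lemma best_approx_error_ge (R : realType) (d : nat) (f : R -> R) (a b c : R) :
  (forall p : {poly R}, (size p <= d.+1)%N ->
     c <= sup [set `|f x - p.[x]| | x in `[a, b]]) ->
  c <= best_approx_error d f a b.
Proof.
move=> cp; apply: lb_le_inf => [|_ [p pd <-]]; last exact: cp.
(* The zero polynomial shows that the infimum is taken over a nonempty set. *)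
by eexists; exists 0 => //=; rewrite size_poly0.
Qed.

Lemma far_row_sqr (R : realType) (n : nat) (A : 'M[R]_n) (a b : R) (f : R -> R)
    (d : nat) (i : 'I_n) (J : {set 'I_n}) :
    A^T = A -> spectrum A `<=` `[a, b] -> {within `[a, b], continuous f} ->
    (forall j, j \in J -> (d%:R%:E < gdist A i j)%E) ->
  \sum_(j in J) matfun f A i j ^+ 2 <= best_approx_error d f a b ^+ 2.
Proof.
move=> AT Aab fc iJ; have [Q [e AQ]] := spectral_decomp_ex AT.
have s0 : 0 <= \sum_(j in J) matfun f A i j ^+ 2.
  by apply: sumr_ge0 => j _; rewrite sqr_ge0.
(* Passing to square roots leaves the error unsquared, so that it can be bounded below one
   polynomial at a time; its nonnegativity is checked first. *)
rewrite -(sqr_sqrtr s0) lerXn2r ?nnegrE ?sqrtr_ge0//.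
  apply: best_approx_error_ge => p _; apply: sup_ge0.
  by move=> _ [x _ <-].
apply: best_approx_error_ge => p pd; set c := sup _.
have c0 : 0 <= c by apply: sup_ge0 => _ [x _ <-].
rewrite -(ger0_norm c0) -sqrtr_sqr ler_wsqrtr//.
have gc x : spectrum A x -> `|f x - p.[x]| <= c.
  by move=> /Aab xab; exact: le_approx_error.
apply: le_trans (matfun_row_sqr i AT gc).
rewrite [leRHS](bigID (mem J))/= -[leLHS]addr0 lerD//; last first.
  by apply: sumr_ge0 => j _; rewrite sqr_ge0.
apply: ler_sum => j jJ; rewrite le_eqVlt; apply/orP; left; apply/eqP.
(* On the columns in [J] the matrix $p(A)$ vanishes, so subtracting it changes nothing there. *)
congr (_ ^+ 2); rewrite -[LHS]subr0.
rewrite -(matfun_poly_eq0 AT pd (iJ _ jJ)) !(matfunEE _ _ _ AQ) -sumrB.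
by apply: eq_bigr => k _; rewrite -mulrBl -mulrBr.
Qed.

(** * Walsh functions of independent fair events *)

(* A Rademacher variable X equals the sign function of the event X = 1 only almost
   surely; [fsign] takes the values 1 and -1 everywhere, so its square is exactly 1. *)
Section Walsh.
Context {R : realType} {disp : measure_display} {T : measurableType disp}.
Variables (P : probability T R) (n : nat) (C : {set 'I_n}) (A : 'I_n -> set T).
Hypothesis A_meas : forall i, measurable (A i).
Hypothesis A_indep : forall K : {set 'I_n}, K \subset C ->
  P (\bigcap_(i in [set` K]) A i) = (2^-1 ^+ #|K|)%:E.

Definition fsign (i : 'I_n) (t : T) : R := 2 * \1_(A i) t - 1.

Definition walsh (J : {set 'I_n}) (t : T) : R := \prod_(i in J) fsign i t.

Lemma fsignK i t : fsign i t * fsign i t = 1.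
Proof. by rewrite /fsign indicE; case: (t \in A i); rewrite /=; ring. Qed.

(** Signs indexed by both sets are squared to 1, and the symmetric difference survives. *)
Lemma walshM J K t : walsh J t * walsh K t = walsh ((J :\: K) :|: (K :\: J)) t.
Proof.
rewrite /walsh big_mkcond [X in _ * X]big_mkcond [RHS]big_mkcond -big_split/=.
apply: eq_bigr => i _; rewrite !inE.
by case: (i \in J); case: (i \in K); rewrite ?fsignK ?mul1r ?mulr1.
Qed.

Lemma measurable_fsign i : measurable_fun setT (fsign i).
Proof.
apply: measurable_funB => //; exact: measurable_funM.
Qed.

Lemma measurable_walsh J : measurable_fun setT (walsh J).
Proof.
rewrite /walsh; under eq_fun do rewrite -big_enum/=.
by apply: measurable_prod => i _; exact: measurable_fsign.
Qed.

Lemma norm_walsh J t : `|walsh J t| = 1.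
Proof.
apply/eqP; rewrite -sqrp_eq1// -normrX expr2 walshM finset.setDv finset.setU0.
by rewrite /walsh big_set0 normr1.
Qed.

Lemma integrable_walsh J (c : R) :
  P.-integrable setT (fun t => (c * walsh J t)%:E).
Proof.
apply: (@measurable_bounded_integrable _ _ _ P (fun t => c * walsh J t)) => //.
- by rewrite (le_lt_trans (probability_le1 P measurableT))// ltry.
- by apply: measurable_funM => //; exact: measurable_walsh.
exists `|c|; split => // M cM t _ /=.
by rewrite normrM norm_walsh mulr1 ltW.
Qed.

(** The product of the factors $2 \cdot 1_{A_i} - 1$ is expanded into indicators of intersections,
    whose probabilities are given by [A_indep]; the resulting sum folds back into a product. *)
Lemma expectation_walsh (J : {set 'I_n}) : J \subset C ->
  (\int[P]_t (walsh J t)%:E = (J == finset.set0)%:R%:E)%E.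
Proof.
move=> JC.
(* [F i + G i] is the sign for [i] in [J] and 1 elsewhere; [c K] is the coefficient of the
   intersection over [K] in the expanded product. *)
pose F i t : R := (i \in J)%:R * 2 * \1_(A i) t.
pose G i : R := if i \in J then -1 else 1.
pose c (K : {set 'I_n}) : R :=
  \prod_i (if i \in K then (i \in J)%:R * 2 else G i).
have mK (K : {set 'I_n}) : measurable (\bigcap_(i in [set` K]) A i).
  by apply: fin_bigcap_measurable => //; exact: finite_finset.
have wE t : (walsh J t)%:E =
    (\sum_(K : {set 'I_n}) (c K * \1_(\bigcap_(i in [set` K]) A i) t)%:E)%E.
  rewrite sumEFin; congr (_%:E).
  transitivity (\prod_i (F i t + G i)).
    rewrite /walsh big_mkcond; apply: eq_bigr => i _; rewrite /F /G.
    by case: (i \in J); rewrite /fsign ?mul1r// mul0r mul0r add0r.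
  rewrite bigA_distr; apply: eq_bigr => K _.
  have -> : \1_(\bigcap_(i in [set` K]) A i) t =
      \prod_i (if i \in K then \1_(A i) t else 1) :> R.
    rewrite indicE; have [/set_mem tK|/negP tK] := boolP (t \in _).
      rewrite big1// => i _; case: ifPn => // iK.
      by rewrite indicE mem_set//; exact: tK.
    have /existsP[i /andP[iK tAi]] : [exists i, (i \in K) && (t \notin A i)].
      apply: contra_notT tK; rewrite negb_exists => /forallP tK.
      apply/mem_set => i /= iK; have := tK i; rewrite iK/= negbK.
      by move/set_mem.
    by rewrite (bigD1 i)//= iK indicE (negbTE tAi) mul0r.
  rewrite -big_split/=; apply: eq_bigr => i _; rewrite /F.
  by case: (i \in K); rewrite ?mulr1.
under eq_integral do rewrite wE.
rewrite integral_sum//; last first.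
  move=> K; under eq_fun do rewrite EFinM.
  apply: integrableZl => //; apply: (@integrable_indic _ _ _ P) => //.
transitivity (\sum_(K : {set 'I_n})
    (\prod_i (if i \in K then (i \in J)%:R else G i))%:E)%E.
  apply: eq_bigr => K _.
  under eq_integral do rewrite EFinM.
  rewrite integralZl//; last by apply: (@integrable_indic _ _ _ P).
  rewrite integral_indic// setIT.
  (* If [K] leaves [J], a zero factor kills both sides; otherwise [K] lies in [C] and each $2^{-1}$
     cancels a factor 2. *)
  have [KJ|/subsetPn[i iK iJ]] := boolP (K \subset J); last first.
    rewrite /c (bigD1 i)//= iK (negbTE iJ) !mul0r mul0e.
    by rewrite (bigD1 i)//= iK (negbTE iJ) mul0r.
  rewrite [X in (_ * X)%E](A_indep (fintype.subset_trans KJ JC)) -EFinM; congr (_%:E).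
  rewrite -prodr_const [X in _ * X]big_mkcond -big_split/=.
  apply: eq_bigr => i _; case: ifPn => iK; last by rewrite mulr1.
  by rewrite -mulrA divff ?mulr1.
(* After refolding, every [i] in [J] contributes the factor $1 + (-1) = 0$. *)
rewrite sumEFin -bigA_distr; congr (_%:E).
have [J0|[i iJ]] := set_0Vmem J.
  by rewrite J0 eqxx big1// => i _; rewrite /G J0 inE/= add0r.
rewrite (bigD1 i)//= /G iJ subrr mul0r; case: eqP => // J0.
by rewrite J0 inE in iJ.
Qed.

(** The condition is restricted to nonzero coefficients because independence is known only inside
    [C], while [I] may also index sets that leave it. *)
Lemma expectation_walsh_sum (I : finType) (c : I -> R) (J : I -> {set 'I_n}) :
    (forall u, c u != 0 -> J u \subset C) ->
  ('E_P[(fun t => \sum_u c u * walsh (J u) t)%R] =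
    (\sum_u c u * (J u == finset.set0)%:R)%:E)%E.
Proof.
move=> JC; rewrite unlock; under eq_integral do rewrite -sumEFin.
rewrite integral_sum//; last by move=> u; exact: integrable_walsh.
rewrite -sumEFin; apply: eq_bigr => u _.
have [->|/JC JuC] := eqVneq (c u) 0.
  by under eq_integral do rewrite mul0r; rewrite integral0 mul0r.
under eq_integral do rewrite EFinM.
rewrite integralZl ?expectation_walsh//.
by have := integrable_walsh (J u) 1; under eq_fun do rewrite mul1r.
Qed.

(** Orthonormality of Walsh functions: centering removes the constant one, and a product of two has
    mean 1 if their sets agree and 0 otherwise. The inner sum collects indices that share a set, as
    [J] may fail to be injective. *)
Lemma variance_walsh_sum (I : finType) (c : I -> R) (J : I -> {set 'I_n}) :
    (forall u, c u != 0 -> J u \subset C) ->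
  ('V_P[(fun t => \sum_u c u * walsh (J u) t)%R] =
    (\sum_(u | J u != finset.set0) \sum_(v | J v == J u) c u * c v)%:E)%E.
Proof.
move=> JC; rewrite /variance unlock expectation_walsh_sum//=.
pose c' u := c u * (J u != finset.set0)%:R.
pose c2 (uv : I * I) := c' uv.1 * c' uv.2.
pose J2 (uv : I * I) := (J uv.1 :\: J uv.2) :|: (J uv.2 :\: J uv.1).
set Y := (X in ('E_P[X])%E).
have -> : Y = (fun t => \sum_uv c2 uv * walsh (J2 uv) t).
  apply/funext => t; rewrite /Y /=.
  have cE : \sum_u c u * walsh (J u) t - \sum_u c u * (J u == finset.set0)%:R =
      \sum_u c' u * walsh (J u) t.
    rewrite -sumrB; apply: eq_bigr => u _; rewrite /c'.
    have [->|_] := eqVneq (J u) finset.set0; last by rewrite mulr0 mulr1 subr0.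
    by rewrite /walsh big_set0 mulr0 mul0r subrr.
  transitivity ((\sum_u c' u * walsh (J u) t) * (\sum_u c' u * walsh (J u) t)).
    by rewrite -cE.
  rewrite big_distrlr/= pair_bigA/=; apply: eq_bigr => uv _.
  by rewrite mulrACA walshM.
rewrite expectation_walsh_sum => [|[u v]].
  congr (_%:E); rewrite -(pair_bigA _ (fun u v => c2 (u, v) * (J2 (u, v) == finset.set0)%:R))/=.
  rewrite [RHS]big_mkcond; apply: eq_bigr => u _; rewrite [X in if _ then X else _]big_mkcond.
  have J2E v : (J2 (u, v) == finset.set0) = (J v == J u).
    rewrite /J2 finset.setU_eq0 !finset.setD_eq0 -finset.eqEsubset eq_sym.
    by rewrite eq_sym.
  rewrite /c2 /c' /=; case: ifPn => Ju; last first.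
    by rewrite big1// => v _; rewrite mulr0 !mul0r.
  apply: eq_bigr => v _; rewrite J2E.
  by have [->|_] := eqVneq (J v) (J u); rewrite ?Ju/= ?mulr0// !mulr1.
rewrite /c2 /c' /J2 /= !mulf_eq0 !negb_or => /andP[/andP[cu _] /andP[cv _]].
by rewrite finset.subUset !finset.subDset !finset.subsetU ?JC ?orbT.
Qed.

(** The factor 2 arises because [(i, j)] and [(j, i)] give the same Walsh function, with equal
    coefficients by symmetry of [F]. *)
Lemma variance_sign_form (F : 'M[R]_n) : F^T = F ->
  ('V_P[(fun t => \sum_(i in C) \sum_(j in C) F i j * (fsign i t * fsign j t))%R] =
    (2 * \sum_(i in C) \sum_(j in C | j != i) F i j ^+ 2)%:E)%E.
Proof.
move=> FT; pose c (u : 'I_n * 'I_n) : R :=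
  if (u.1 \in C) && (u.2 \in C) then F u.1 u.2 else 0.
(* Symmetric differences make the diagonal terms of the form the constant Walsh
   function, which does not contribute to the variance. *)
pose J (u : 'I_n * 'I_n) : {set 'I_n} :=
  ([set u.1] :\: [set u.2])%SET :|: ([set u.2] :\: [set u.1])%SET.
have inJ x u : (x \in J u) = (x == u.1) (+) (x == u.2).
  by rewrite !inE; case: (x == u.1); case: (x == u.2).
set Y := (X in ('V_P[X])%E).
have -> : Y = (fun t => \sum_u c u * walsh (J u) t).
  apply/funext => t; rewrite /Y pair_big_dep/= big_mkcond; apply: eq_bigr => u _.
  rewrite /c; case: ifP => _; rewrite ?mul0r//.
  by rewrite -walshM /walsh !big_set1.
rewrite variance_walsh_sum => [|u]; last first.
  rewrite /c; case: ifP; rewrite ?eqxx// => /andP[u1 u2] _.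
  by rewrite finset.subUset !finset.subDset !finset.subsetU ?finset.sub1set ?u1 ?u2 ?orbT.
congr (_%:E); rewrite [in RHS]pair_big_dep/= mulr_sumr big_mkcond [RHS]big_mkcond.
have J0 u : (J u == finset.set0) = (u.1 == u.2).
  apply/eqP/eqP => [/setP/(_ u.1)|u12]; rewrite ?inJ ?eqxx ?inE.
    by move=> /negbFE/eqP.
  by apply/setP => x; rewrite inJ u12 addbb inE.
have JJ i j v : i != j -> (J v == J (i, j)) = (v == (i, j)) || (v == (j, i)).
  move=> ij; case: v => k l; apply/eqP/idP => [/setP JE|]; last first.
    case/orP=> /eqP[-> ->] //; apply/setP => x; rewrite !inJ/=.
    by rewrite addbC.
  (* Testing membership of [i] and [j] themselves identifies the pair up to order. *)
  have := JE i; have := JE j; rewrite !inJ/= !xpair_eqE !eqxx.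
  have ji : (j == i) = false by rewrite eq_sym (negbTE ij).
  rewrite ji (negbTE ij)/=; have [<-|_] := eqVneq i k.
    by rewrite ji /= => /eqP <-; rewrite eqxx.
  move=> + /eqP il; rewrite -il ji addbF => /eqP <-.
  by rewrite !eqxx orbT.
apply: eq_bigr => -[i j] _; rewrite J0/=.
have [->|ij] := eqVneq i j; first by rewrite !andbF.
rewrite !andbT.
under eq_bigl do rewrite JJ//.
rewrite (bigD1 (i, j)) ?eqxx//= (bigD1 (j, i))/=; last first.
  by rewrite eqxx orbT xpair_eqE negb_and eq_sym ij.
rewrite big1 ?addr0 => [|v]; last by case: eqP => //=; case: eqP.
have Fji : F j i = F i j by rewrite -[in LHS]FT mxE.
rewrite /c /= Fji [(j \in C) && _]andbC; case: ifP => _; rewrite ?mul0r ?addr0//.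
by ring.
Qed.
End Walsh.

(** * From sign functions to Rademacher probing vectors *)

(** Both the mean and the variance are expectations of [G \o Y] for a measurable [G]: the identity,
    then the square centered at the common mean. Such expectations ignore null sets. *)
Lemma ae_eq_variance (R : realType) (disp : measure_display)
    (T : measurableType disp) (P : probability T R) (Y Z : T -> R) :
    measurable_fun setT Y -> measurable_fun setT Z ->
    {ae P, forall t, Y t = Z t} ->
  ('V_P[Y] = 'V_P[Z])%E.
Proof.
move=> mY mZ YZ.
have E (G : R -> R) : measurable_fun setT G ->
    ('E_P[G \o Y] = 'E_P[G \o Z])%E.
  move=> mG; rewrite unlock; apply: ae_eq_integral => //.
  - by apply/measurable_EFinP; exact: measurableT_comp.
  - by apply/measurable_EFinP; exact: measurableT_comp.
  - by apply: filterS YZ => t YZt _ /=; rewrite YZt.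
rewrite /variance unlock.
have EYZ : 'E_P[Y]%E = 'E_P[Z]%E by exact: (E id).
rewrite EYZ; set m := fine _; apply: (E (fun x => (x - m) * (x - m))).
by apply: measurable_funM; apply: measurable_funB.
Qed.

Lemma quad_form_probing (R : realType) (n : nat) (M : 'M[R]_n) (C : {set 'I_n})
    (x : 'I_n -> R) :
  quad_form M (\sum_(i in C) x i *: delta_mx i 0) =
  \sum_(i in C) \sum_(j in C) M i j * (x i * x j).
Proof.
set w := (X in quad_form M X).
have wE k : w k 0 = if k \in C then x k else 0.
  rewrite /w summxE; case: ifP => kC.
    rewrite (bigD1 k)//= big1 ?addr0 => [|i /andP[_ ik]]; rewrite !mxE eqxx.
      by rewrite mulr1.
    by rewrite eq_sym (negbTE ik) mulr0.
  rewrite big1// => i iC; rewrite !mxE.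
  by case: eqP iC => [<-|_ _]; rewrite ?kC// mulr0.
rewrite /quad_form mxE [RHS]big_mkcond/= (eq_bigr (fun j =>
    \sum_i w i 0 * M i j * w j 0)); last first.
  by move=> j _; rewrite mxE mulr_suml; apply: eq_bigr => i _; rewrite mxE.
rewrite exchange_big; apply: eq_bigr => i _/=; rewrite wE; case: ifP => iC.
  rewrite [RHS]big_mkcond; apply: eq_bigr => j _; rewrite wE.
  by case: ifP => _; rewrite ?mulr0//; ring.
by rewrite big1// => j _; rewrite !mul0r.
Qed.

(** The two disjoint events have total mass $1/2 + 1/2 = 1$, so their complement is null. *)
Lemma rademacher_ae (R : realType) (disp : measure_display)
    (T : measurableType disp) (P : probability T R) (X : {RV P >-> R}) :
  rademacher X -> {ae P, forall t, X t = 1 \/ X t = -1}.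
Proof.
move=> [X1 XN1].
have mX (r : R) : measurable (X @^-1` [set r]).
  by rewrite -[_ @^-1` _]setTI; exact: measurable_funP.
exists (~` (X @^-1` [set 1] `|` X @^-1` [set -1])); split.
- by apply: measurableC; exact: measurableU.
- have half2 : 2^-1 + 2^-1 = 1 :> R by field.
  rewrite probability_setC; last exact: measurableU.
  rewrite measureU//.
    by rewrite [X in (_ - (X + _))%E]X1 [X in (_ - (_ + X))%E]XN1 -EFinD half2 subrr.
  rewrite -subset0 => t [/= -> /eqP].
  by rewrite -subr_eq0 opprK -(natrD _ 1 1) pnatr_eq0.
- by move=> t h /= [h1|h1]; apply: h; [left|right].
Qed.

Lemma measurable_bilinear (R : realType) (n : nat) (M : 'M[R]_n) (C : {set 'I_n})
    (disp : measure_display) (T : measurableType disp) (X : 'I_n -> T -> R) :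
  (forall i, measurable_fun setT (X i)) ->
  measurable_fun setT
    (fun t => \sum_(i in C) \sum_(j in C) M i j * (X i t * X j t)).
Proof.
move=> mX; under eq_fun do rewrite -big_enum/=.
apply: measurable_sum => i; under eq_fun do rewrite -big_enum/=.
apply: measurable_sum => j.
by apply: measurable_funM => //; exact: measurable_funM.
Qed.

Lemma variance_probing (R : realType) (n : nat) (F : 'M[R]_n) (C : {set 'I_n})
    (disp : measure_display) (T : measurableType disp) (P : probability T R)
    (w : T -> 'cV[R]_n) :
  F^T = F -> rademacher_probing P C w ->
  ('V_P[fun t => quad_form F (w t)] =
    (2 * \sum_(i in C) \sum_(j in C | j != i) F i j ^+ 2)%:E)%E.
Proof.
move=> FT [X [Xrad Xind wE]].
pose A i := X i @^-1` [set 1].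
have mA i : measurable (A i).
  by rewrite /A -[_ @^-1` _]setTI; exact: measurable_funP.
have Aind (K : {set 'I_n}) : K \subset C ->
    P (\bigcap_(i in [set` K]) A i) = (2^-1 ^+ #|K|)%:E.
  (* Independence of the variables is used only for the events $X_i = 1$. *)
  move=> KC; rewrite (Xind K (fun=> [set 1]) KC)//.
  rewrite -prodr_const -prodEFin; apply: eq_bigr => i iK.
  by have [] := Xrad i (fintype.subsetP KC _ iK).
rewrite -(variance_sign_form mA Aind FT); apply: ae_eq_variance.
- under eq_fun do rewrite wE quad_form_probing.
  by apply: measurable_bilinear => i; exact: measurable_funP.
- by apply: measurable_bilinear => i; exact: measurable_fsign.
have : {ae P, forall t, forall i, i \in C -> X i t = 1 \/ X i t = -1}.
  (* There are finitely many indices, so the exceptional null sets can be merged. *)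
  apply: filter_forall => i.
  have [iC|iC] := boolP (i \in C).
    by apply: filterS (rademacher_ae (Xrad i iC)) => t.
  by apply: aeW => t.
apply: filterS => t Xt; rewrite wE quad_form_probing.
have XS i : i \in C -> X i t = fsign A i t.
  rewrite /fsign indicE => /Xt[Xi|Xi].
    by rewrite mem_set//= Xi; ring.
  rewrite memNset ?Xi/=; first by ring.
  rewrite /A /= Xi => /esym/eqP.
  by rewrite -subr_eq0 opprK -(natrD _ 1 1) pnatr_eq0.
by apply: eq_bigr => i iC; apply: eq_bigr => j jC; rewrite !XS.
Qed.

Theorem proposition3p10 (R : realType) (n : nat) (A : 'M[R]_n) (a b : R)
    (f : R -> R) (d m : nat) (col : 'I_n -> 'I_m)
    (A_sym : A^T = A)
    (A_spec : spectrum A `<=` `[a, b])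
    (f_cont : {within `[a, b], continuous f})
    (d_ge1 : (1 <= d)%N)
    (col_dist : distance_coloring A d col)
    (f_sign :
      (forall i j, (d%:R%:E < gdist A i j)%E -> 0 <= matfun f A i j) \/
      (forall i j, (d%:R%:E < gdist A i j)%E -> matfun f A i j <= 0))
    (l : 'I_m)
    (disp : measure_display) (T : measurableType disp) (P : probability T R)
    (w : T -> 'cV[R]_n)
    (w_probing : rademacher_probing P (color_class col l) w) :
  ('V_P[fun t => quad_form (matfun f A) (w t)] <=
    (#|color_class col l|%:R * (4 * best_approx_error d f a b ^+ 2))%:E)%E.
Proof.
rewrite (variance_probing (matfun_sym f A_sym) w_probing) lee_fin.
set E := best_approx_error d f a b; set C := color_class col l.
have row_le i : i \in C -> \sum_(j in C | j != i) matfun f A i j ^+ 2 <= E ^+ 2.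
  move=> iC; rewrite (eq_bigl (mem (C :\ i)%SET)) => [|j]; last first.
    by rewrite !inE andbC.
  (* Two distinct vertices of one color are more than [d] apart, so the rest of the color class is
     an admissible set of columns for row [i]. *)
  apply: far_row_sqr => // j; rewrite !inE => /andP[ji /eqP jl].
  rewrite ltNge; apply/negP => /(col_dist i j); rewrite eq_sym => /(_ ji).
  by move: iC; rewrite inE => /eqP ->; rewrite jl eqxx.
apply: (@le_trans _ _ (2 * (#|C|%:R * E ^+ 2))).
  rewrite ler_pM2l// mulr_natl -sumr_const.
  by apply: ler_sum => i; exact: row_le.
rewrite mulrCA ler_wpM2l// ler_wpM2r ?sqr_ge0// ler_nat//.
Qed.
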